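(* For every positive integer $n$, $$g_n(\mathbb{C}) \le n^{\frac{\ln n}{2[2+(2-\sqrt{2})\ln 2]} + 0.91},$$ where $g_n(\mathbb{C})$ is the maximum growth factor of Gaussian elimination with complete pivoting over all non-singular $n\times n$ complex matrices.
   Context: For a matrix $M$, $\|M\|_{\max}$ denotes the largest modulus of an entry of $M$. Given $A\in\mathbb{C}^{n\times n}$, Gaussian elimination (without interchanges) produces the matrices $A^{(k)}\in\mathbb{C}^{k\times k}$ for $k=n,n-1,\dots,1$, where $A^{(n)}=A$ and, for $k<n$, $$A^{(k)} = M^{(2,2)} - M^{(2,1)}[M^{(1,1)}]^{-1}M^{(1,2)}, \qquad A=\begin{bmatrix} M^{(1,1)} & M^{(1,2)}\\ M^{(2,1)} & M^{(2,2)}\end{bmatrix},$$ with $M^{(1,1)}$ of size $(n-k)\times(n-k)$ (assumed invertible) and $M^{(2,2)}$ of size $k\times k$. The growth factor of $A$ is $$g(A) = \frac{\max_{1\le k\le n}\|A^{(k)}\|_{\max}}{\|A\|_{\max}}.$$ The pivot of $A^{(k)}$ is its top-left entry. Complete pivoting permutes rows and columns so that at each step the pivot of $A^{(k)}$ is an entry of largest modulus in $A^{(k)}$. A non-singular matrix $A$ is called completely pivoted if all the $A^{(k)}$ are defined and, for each $k=1,\dots,n$, the modulus of the top-left entry of $A^{(k)}$ equals $\|A^{(k)}\|_{\max}$. Every non-singular matrix becomes completely pivoted after suitable row and column permutations, so $g_n(\mathbb{C})$ is the maximum of $g(A)$ over all non-singular completely pivoted $A\in\mathbb{C}^{n\times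 n}$. Arithmetic is exact. *)

(* Defs.v *)
From mathcomp Require Import all_boot all_order all_algebra.
From mathcomp Require Import complex.
From mathcomp Require Import boolp classical_sets reals ereal exp.

Set Implicit Arguments.
Unset Strict Implicit.
Unset Printing Implicit Defensive.

Import Order.TTheory GRing.Theory Num.Theory.
Local Open Scope ring_scope.
Local Open Scope classical_set_scope.

Section GaussianElimination.
Variable R : realType.

(* [Normc.normc] is the modulus as an element of [R]; [`|z|] would lie in
   [R[i]], which is only partially ordered. *)
Definition maxnorm m n (M : 'M[R[i]]_(m, n)) : R :=
  \big[Num.max/0]_(i < m) \big[Num.max/0]_(j < n) Normc.normc (M i j).

Section Elimination.
Variables (n k : nat) (le_kn : (k <= n)%N) (A : 'M[R[i]]_n).

Definition ge_block : 'M[R[i]]_(n - k + k) :=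
  castmx (esym (subnK le_kn), esym (subnK le_kn)) A.

Definition ge_defined : bool := ulsubmx ge_block \in unitmx.

(* The matrix A^(k); meaningful only under [ge_defined], since [invmx] is the
   identity on singular matrices.  For k = n the leading block is 0 x 0 (hence
   invertible) and A^(n) = A. *)
Definition ge_mx : 'M[R[i]]_k :=
  drsubmx ge_block
  - dlsubmx ge_block *m invmx (ulsubmx ge_block) *m ursubmx ge_block.

End Elimination.

(* The sizes k = 1, ..., n are indexed by i : 'I_n through k = i.+1, where
   [ltn_ord i] is a proof of i.+1 <= n. *)
Definition growth n (A : 'M[R[i]]_n) : R :=
  (\big[Num.max/0]_(i < n) maxnorm (ge_mx (ltn_ord i) A)) / maxnorm A.

Definition completely_pivoted n (A : 'M[R[i]]_n) : Prop :=
  A \in unitmx /\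
  forall i : 'I_n, ge_defined (ltn_ord i) A /\
    Normc.normc (ge_mx (ltn_ord i) A ord0 ord0)
      = maxnorm (ge_mx (ltn_ord i) A).

(* Taken in the extended reals: the supremum of an unbounded set would be 0 in
   [R], making an upper bound vacuous, while here it is +oo. *)
Definition max_growth n : \bar R :=
  ereal_sup [set (growth A)%:E | A in [set A : 'M[R[i]]_n | completely_pivoted A]].

End GaussianElimination.

Arguments max_growth : clear implicits.

(* Main.v *)
Require Import Defs.
From mathcomp Require Import all_boot all_order all_algebra.
From mathcomp Require Import complex spectral sesquilinear ring lra zify.
From mathcomp Require Import boolp classical_sets reals ereal.
From mathcomp Require Import topology normedtype derive realfun exp.

Set Implicit Arguments.
Unset Strict Implicit.
Unset Printing Implicit Defensive.

Import Order.TTheory GRing.Theory Num.Theory numFieldNormedType.Exports.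
Local Open Scope ring_scope.

(* Let [p_k] be the modulus of the pivot of [A^(k)].  Then [|det A^(l)|] is the
   product of the [p_i], [i <= l], and Wilkinson's bound follows from Hadamard's
   inequality applied to each [A^(l)].  The improvement uses that [A^(l)]
   differs from a block of [A^(l+s)], whose entries are at most [p_(l+s)], by a
   matrix of rank [s]: in an orthonormal basis adapted to the nested kernels of
   these updates, the squared norms of all but the first [s] columns of [A^(l)]
   sum to at most [l^2 p_(l+s)^2].  With [q_i = ln p_i] and [S_l] the sum of the
   [q_i], [i <= l], this gives, for [1 <= u <= l],
     [2 S_l <= S_(2l-u) + u q_l + l ln l - (l/2) ln u].
   In terms of the means [S_l / l], the case [u = l] bounds their successive
   differences (Wilkinson); call deficit the amount by which a difference falls
   short of that bound.  The inequalities with [u] close to [l/5], weighted by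
   about [1/l] and summed over [l], force the total deficit to be at least of
   order [(ln n)^2], enough for all [n] with [ln n > 7]; for smaller [n]
   Wilkinson's bound suffices. *)

(** * Rational bounds on logarithms *)

Section Logarithm.
Variable R : realType.
Implicit Types x y : R.

Lemma nneg_from_derive (f df : R -> R) x : f 1 = 0 ->
  (forall y, 0 < y -> is_derive y 1 f (df y)) ->
  (forall y, 1 <= y -> 0 <= df y) -> 1 <= x -> 0 <= f x.
Proof.
move=> f1 fD df0 x1.
have yP y : y \in `[1, x]%R -> 0 < y.
  by rewrite in_itv /= => /andP[y1 _]; exact: lt_le_trans y1.
have [||c] := @MVT_segment R f df 1 x x1.
- by move=> y yx; apply: fD; apply: yP; exact: subset_itv_oo_cc.
- apply: derivable_within_continuous => y yx.
  exact: (@ex_derive _ _ _ _ _ _ _ (fD y (yP y yx))).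
rewrite f1 subr0 in_itv /= => /andP[c1 _] ->.
by rewrite mulr_ge0 ?df0 // subr_ge0.
Qed.

(** The quotient is the [2/2] Padé approximant of [ln] at 1, so the derivative of the difference is
    the single nonnegative fraction [df]. *)
Lemma ln_ge_pade x : 1 <= x -> 3 * (x ^+ 2 - 1) / (x ^+ 2 + 4 * x + 1) <= ln x.
Proof.
move=> x1; rewrite -subr_ge0.
pose df y : R := (y - 1) ^+ 4 / (y * (y ^+ 2 + 4 * y + 1) ^+ 2).
refine (@nneg_from_derive (fun y => ln y - 3 * (y ^+ 2 - 1) / (y ^+ 2 + 4 * y + 1)) df x _ _ _ x1).
- by rewrite ln1; lra.
- move=> y y0.
  have d0 : y ^+ 2 + 4 * y + 1 != 0 by rewrite gt_eqF //; nra.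
  have dl := is_derive1_ln y0.
  apply: is_derive_eq.
  rewrite /df /GRing.scale /=.
  by field; rewrite d0 gt_eqF.
- move=> y y1; rewrite /df divr_ge0 ?exprn_even_ge0 // mulr_ge0 ?exprn_even_ge0 //; lra.
Qed.

(** The [2/1] Padé approximant at 1, which lies on the other side. *)
Lemma ln_le_pade x : 1 <= x -> ln x <= (x - 1) * (x + 5) / (4 * x + 2).
Proof.
move=> x1; rewrite -subr_ge0.
pose df y : R := (y - 1) ^+ 3 / (y * (2 * y + 1) ^+ 2).
refine (@nneg_from_derive (fun y => (y - 1) * (y + 5) / (4 * y + 2) - ln y) df x _ _ _ x1).
- by rewrite ln1; lra.
- move=> y y0.
  have d0 : 4 * y + 2 != 0 by rewrite gt_eqF //; nra.
  have dl := is_derive1_ln y0.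
  apply: is_derive_eq.
  rewrite /df /GRing.scale /=.
  by field; rewrite d0 !gt_eqF //; lra.
- move=> y y1; rewrite /df divr_ge0 ?exprn_ge0 ?mulr_ge0 ?exprn_even_ge0 //; lra.
Qed.

Lemma ln_le_tangent x y : 0 < x -> 0 < y -> ln y <= ln x + (y - x) / x.
Proof.
move=> x0 y0; rewrite -lerBlDl -ln_div //.
have -> : y / x = 1 + (y - x) / x by field; rewrite gt_eqF.
apply: le_ln1Dx; rewrite -subr_gt0.
have -> : (y - x) / x - -1 = y / x by field; rewrite gt_eqF.
exact: divr_gt0.
Qed.

(** This is the midpoint rule for the integral of 1/t over [x, y]; the sharper Padé bound at [y / x]
    implies it. *)
Lemma ln_diff_ge x y : 0 < x -> x <= y -> 2 * (y - x) / (x + y) <= ln y - ln x.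
Proof.
move=> x0 xy; have y0 := lt_le_trans x0 xy; rewrite -ln_div //.
have r1 : 1 <= y / x by rewrite ler_pdivlMr // mul1r.
have -> : 2 * (y - x) / (x + y) = 2 * (y / x - 1) / (y / x + 1).
  by field; rewrite !gt_eqF //= addr_gt0.
apply: le_trans (ln_ge_pade r1).
move: (y / x) r1 => r r1; rewrite -subr_ge0.
have -> : 3 * (r ^+ 2 - 1) / (r ^+ 2 + 4 * r + 1) - 2 * (r - 1) / (r + 1)
    = (r - 1) ^+ 3 / ((r + 1) * (r ^+ 2 + 4 * r + 1)).
  by field; rewrite !gt_eqF //; nra.
by rewrite divr_ge0 ?exprn_ge0 ?mulr_ge0 // ?subr_ge0 //; nra.
Qed.

(** The trapezoidal rule for the same integral. *)
Lemma ln_diff_le x y : 0 < x -> x <= y -> ln y - ln x <= (y ^+ 2 - x ^+ 2) / (2 * x * y).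
Proof.
move=> x0 xy; have y0 := lt_le_trans x0 xy; rewrite -ln_div //.
have r1 : 1 <= y / x by rewrite ler_pdivlMr // mul1r.
have -> : (y ^+ 2 - x ^+ 2) / (2 * x * y) = ((y / x) ^+ 2 - 1) / (2 * (y / x)).
  by field; rewrite !gt_eqF.
apply: le_trans (ln_le_pade r1) _.
move: (y / x) r1 => r r1; rewrite -subr_ge0.
have -> : (r ^+ 2 - 1) / (2 * r) - (r - 1) * (r + 5) / (4 * r + 2)
    = (r - 1) ^+ 3 / (2 * r * (2 * r + 1)).
  by field; rewrite !gt_eqF //; lra.
by rewrite divr_ge0 ?exprn_ge0 ?mulr_ge0 // ?subr_ge0 //; lra.
Qed.

Lemma ln_lower c x : 1 <= x -> c * (x * x + 4 * x + 1) <= 3 * (x * x - 1) ->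
  c <= ln x.
Proof.
by move=> x1 cx; apply: le_trans (ln_ge_pade x1); rewrite ler_pdivlMr; nra.
Qed.

Lemma ln_upper c x : 1 <= x -> (x - 1) * (x + 5) <= c * (4 * x + 2) -> ln x <= c.
Proof.
by move=> x1 cx; apply: le_trans (ln_le_pade x1) _; rewrite ler_pdivrMr; nra.
Qed.

Lemma ln2_ge : 692 / 1000 <= ln 2 :> R.
Proof. by apply: ln_lower; lra. Qed.

Let ln54_le : ln (5 / 4) <= 67 / 300 :> R.
Proof. by apply: ln_upper; lra. Qed.

Let ln128125_le : ln (128 / 125) <= 1 / 42 :> R.
Proof. by apply: ln_upper; lra. Qed.

Lemma ln2_le : ln 2 <= 694 / 1000 :> R.
Proof.
(* Both 5/4 and 128/125 are close to 1, where the Padé bounds are sharp. *)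
have -> : 2 = (5/4) ^+ 3 * (128/125) :> R by field.
rewrite lnM ?posrE ?exprn_gt0 // ?lnXn; try lra.
by have := ln54_le; have := ln128125_le; lra.
Qed.

Lemma ln5_le : ln 5 <= 1611 / 1000 :> R.
Proof.
have -> : 5 = (5/4) ^+ 7 * (128/125) ^+ 2 :> R by field.
rewrite lnM ?posrE ?exprn_gt0 // ?lnXn; try lra.
by have := ln54_le; have := ln128125_le; lra.
Qed.

Lemma ln95_ge : 587 / 1000 <= ln (9 / 5) :> R.
Proof. by apply: ln_lower; lra. Qed.

Lemma ln95_le : ln (9 / 5) <= 53 / 90 :> R.
Proof.
have -> : 9/5 = (6/5) * (3/2) :> R by lra.
rewrite lnM ?posrE; try lra.
have : ln (6/5) <= 31 / 170 :> R by apply: ln_upper; lra.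
have : ln (3/2) <= 13 / 32 :> R by apply: ln_upper; lra.
lra.
Qed.

End Logarithm.

(** * Wilkinson's sum and the deficit *)

Section Wilkinson.
Variable R : realType.

(* Hadamard's inequality bounds [mean j - mean j.+1] by this. *)
Definition wilkinson_step (j : nat) : R := ln j.+1%:R / (2 * j%:R).

Lemma ln_nat_succ_le (n : nat) : (0 < n)%N ->
  ln n.+1%:R - ln n%:R <= n%:R^-1 :> R.
Proof.
move=> n0; have nR : 0 < n%:R :> R by rewrite ltr0n.
have := @ln_le_tangent R n%:R n.+1%:R nR (ltr0Sn _ _).
by rewrite -natr1 addrAC subrr add0r div1r; lra.
Qed.

Lemma ln_nat_succ_ge (n : nat) : (0 < n)%N ->
  n.+1%:R^-1 <= ln n.+1%:R - ln n%:R :> R.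
Proof.
move=> n0; have nR : 0 < n%:R :> R by rewrite ltr0n.
have := @ln_le_tangent R n.+1%:R n%:R (ltr0Sn _ _) nR.
by rewrite -natr1 opprD addrA subrr add0r mulN1r; lra.
Qed.

Lemma ln_nat_ge0 (n : nat) : 0 <= ln n%:R :> R.
Proof. by case: n => [|n]; [rewrite ln0 | rewrite ln_ge0 // ler1n]. Qed.

(** Each increment of [ln ^+ 2 / 4] is a quarter of a difference of logarithms, at most 1/n, times a
    sum, at most [2 * ln n.+1]. *)
Lemma sum_wilkinson_step_ge (l k : nat) : (0 < l)%N -> (l <= k)%N ->
  (ln k%:R ^+ 2 - ln l%:R ^+ 2) / 4 <= \sum_(l <= j < k) wilkinson_step j.
Proof.
move=> l0 /subnK <-; elim: (k - l)%N => [|d IH].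
  by rewrite add0n big_geq // subrr mul0r.
rewrite addSn big_nat_recr /=; last by rewrite leq_addl.
have n0 : (0 < d + l)%N by lia.
move: (d + l)%N n0 IH => n n0 IH.
have := ln_nat_succ_le n0; have := ln_nat_succ_ge n0.
have := ln_nat_ge0 n; have := ln_nat_ge0 n.+1.
rewrite /wilkinson_step invfM.
have : 0 < n%:R^-1 :> R by rewrite invr_gt0 ltr0n.
have : 0 < n.+1%:R^-1 :> R by rewrite invr_gt0 ltr0n.
move: (ln n%:R) (ln n.+1%:R) (n%:R^-1) (n.+1%:R^-1) IH => x y i i' IH; nra.
Qed.

(* The exact second order behaviour of the increments is [(ln n + 1) / (4 n^2)],
   which suggests the correction term. *)
Lemma sum_wilkinson_step_le (m : nat) : (0 < m)%N ->
  \sum_(1 <= j < m) wilkinson_step j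
    <= ln m%:R ^+ 2 / 4 + 16 / 25 - (ln m%:R / 4 + 16 / 25) / m%:R.
Proof.
case: m => // m _; elim: m => [|n IH].
  by rewrite big_geq // ln1; lra.
rewrite big_nat_recr //=.
(* The estimates below use [p >= 2]; the step from 1 to 2 is numerical. *)
case: n IH => [|n] IH.
  rewrite big_geq // /wilkinson_step.
  by have := ln2_ge R; have := ln2_le R; move: (ln 2) => x; nra.
move: IH; set p := n.+2 => IH; rewrite /wilkinson_step.
have p2 : 2 <= p%:R :> R by rewrite ler_nat.
have dge := @ln_diff_ge R p%:R p.+1%:R ltac:(lra) ltac:(by rewrite ler_nat).
have dle := @ln_diff_le R p%:R p.+1%:R ltac:(lra) ltac:(by rewrite ler_nat).
have Lle : ln p.+1%:R <= 111 / 100 + (p%:R - 2) / 3 :> R.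
  have := @ln_le_tangent R 3 p.+1%:R ltac:(lra) ltac:(by rewrite ltr0n).
  have : ln 3 <= 111 / 100 :> R.
    have -> : 3 = (3/2) * 2 :> R by field.
    rewrite lnM ?posrE; try lra.
    have := ln2_le R; have : ln (3/2) <= 13 / 32 :> R by apply: ln_upper; lra.
    lra.
  by rewrite -[p.+1%:R]natr1; lra.
have L0 := ln_nat_ge0 p; have L0' := ln_nat_ge0 p.+1.
apply: le_trans (lerD IH (lexx _)) _.
move: dge dle Lle L0 L0' p2; rewrite -[p.+1%:R]natr1.
move: (ln p%:R) (ln (p%:R + 1)) => x y; move: (p%:R) => t dge dle yle x0 y0 t2.
have t0 : t != 0 by rewrite gt_eqF //; lra.
have t1 : t + 1 != 0 by rewrite gt_eqF //; lra.
have t3 : 2 * t + 1 != 0 by rewrite gt_eqF //; lra.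
set D := ((t + 1) ^+ 2 - t ^+ 2) / (2 * t * (t + 1)) in dle.
have i0 : 0 < t^-1 by rewrite invr_gt0; lra.
have d0 : 0 <= y - x by apply: (le_trans _ dge); rewrite divr_ge0 //; lra.
have lin : y * (2 * (t + 1 - t) / (t + (t + 1))) <= y * (y - x) by rewrite ler_wpM2l.
have linD : (y - x) / t <= D / t by rewrite ler_wpM2r // ltW.
have sqD : (y - x) ^+ 2 <= D ^+ 2 by rewrite ler_sqr ?nnegrE //; exact: le_trans d0 dle.
have liny : y / (t * (t + 1) * (2 * t + 1)) <=
    (111 / 100 + (t - 2) / 3) / (t * (t + 1) * (2 * t + 1)).
  by rewrite ler_wpM2r // invr_ge0 !mulr_ge0; lra.
(* Once the logarithms are bounded, it remains to see that this rational function is nonnegative for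
   [t >= 2]. *)
have key : 0 <= 64 * (t * (t + 1))^-1 - 25 * (D / t) - 25 * D ^+ 2
     - 25 * ((111 / 100 + (t - 2) / 3) / (t * (t + 1) * (2 * t + 1))).
  have -> : 64 * (t * (t + 1))^-1 - 25 * (D / t) - 25 * D ^+ 2
     - 25 * ((111 / 100 + (t - 2) / 3) / (t * (t + 1) * (2 * t + 1))) =
     (12 * 64 * t * (t + 1) * (2 * t + 1) - 150 * (2 * t + 1) ^+ 2 * (t + 1)
     - 75 * (2 * t + 1) ^+ 3 - (100 * t + 133) * t * (t + 1))
      / (12 * t ^+ 2 * (t + 1) ^+ 2 * (2 * t + 1)).
    by rewrite /D; field; rewrite t0 t1 t3.
  by rewrite divr_ge0 ?mulr_ge0 ?exprn_ge0 //; nra.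
have -> : x ^+ 2 / 4 + 16 / 25 - (x / 4 + 16 / 25) / t + y / (2 * t) =
   x ^+ 2 / 4 + 16 / 25 - x / 4 * t^-1 - 16 / 25 * t^-1 + y / 2 * t^-1 by field.
have -> : (y / 4 + 16 / 25) / (t + 1) = (y / 4 + 16/25) * (t^-1 - (t * (t + 1))^-1).
  by field; rewrite ?t0 ?t1.
have e : 2 * (t + 1 - t) / (t + (t + 1)) =
   t^-1 - 1 / 2 * (t * (t + 1))^-1 - 1 / 2 * (t * (t + 1) * (2 * t + 1))^-1.
  by field; rewrite t0 t1 t3.
move: lin linD sqD liny key; rewrite e {e}.
move: (D ^+ 2) (t^-1) ((t * (t + 1))^-1) ((t * (t + 1) * (2 * t + 1))^-1) => D2 i a b.
move=> h1 h2 h3 h4 h5; clearbody D; lra.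
Qed.
End Wilkinson.

Lemma ler_sum_nat_sub (R : numDomainType) (a b c d : nat) (P : pred nat)
    (f : nat -> R) :
  (forall l, (a <= l < b)%N -> P l -> (c <= l < d)%N) ->
  (forall l, (c <= l < d)%N -> 0 <= f l) ->
  \sum_(a <= l < b | P l) f l <= \sum_(c <= l < d) f l.
Proof.
move=> sub f0.
rewrite (big_nat_widenl a 0) // (big_nat_widen _ b (b + d)) ?leq_addr //.
rewrite (big_nat_widenl c 0) // (big_nat_widen _ d (b + d)) ?leq_addl //.
rewrite [leLHS]big_mkcond [leRHS]big_mkcond /=; apply: ler_sum => l _.
case: ifP => [/andP[/andP[Pl al] lb]|_].
  by have /andP[-> ->] := sub l ltac:(by rewrite al) Pl.
by case: ifP => // cld; rewrite f0.
Qed.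

Section Deficit.
Variables (R : realType) (q : nat -> R).

(* [q i] is the logarithm of the pivot of the [i] x [i] remaining matrix. *)
Definition psum (l : nat) : R := \sum_(1 <= i < l.+1) q i.
Definition mean (l : nat) : R := psum l / l%:R.
Definition deficit (j : nat) : R := wilkinson_step R j - (mean j - mean j.+1).

Lemma mul_mean l : l%:R * mean l = psum l.
Proof.
case: l => [|l]; first by rewrite mul0r /psum big_geq.
by rewrite mulrC divfK // pnatr_eq0.
Qed.

Lemma sum_deficit l k : (l <= k)%N ->
  \sum_(l <= j < k) deficit j
    = \sum_(l <= j < k) wilkinson_step R j - (mean l - mean k).
Proof.
move=> lk; rewrite sumrB; congr (_ - _).
under eq_bigr do rewrite -opprB.
by rewrite sumrN telescope_sumr // opprB.
Qed.

Definition pivot_ineq (m : nat) := forall l u : nat,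
  (0 < u <= l)%N -> (2 * l - u <= m)%N ->
  2 * psum l <= psum (2 * l - u) + u%:R * q l + l%:R * ln l%:R - l%:R / 2 * ln u%:R.

Variable m : nat.
Hypothesis qP : pivot_ineq m.

Lemma deficit_ineq l u : (0 < u <= l)%N -> (2 * l - u <= m)%N ->
  (2 * l - u)%:R * \sum_(l <= j < 2 * l - u) wilkinson_step R j
    + u%:R / 2 * ln l%:R - l%:R * ln l%:R + l%:R / 2 * ln u%:R
  <= (2 * l - u)%:R * \sum_(l <= j < 2 * l - u) deficit j
    + u%:R * l.-1%:R * deficit l.-1.
Proof.
move=> ul km; have := qP ul km; rewrite sum_deficit; last by lia.
have kR : (2 * l - u)%:R = 2 * l%:R - u%:R :> R.
  by rewrite natrB ?natrM //; lia.
move: (2 * l - u)%N kR {km} => k kR; rewrite -(mul_mean k).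
case: l ul kR => [|l]; first by lia.
move=> ul kR; rewrite /deficit /= -(mul_mean l.+1).
have -> : q l.+1 = l.+1%:R * mean l.+1 - l%:R * mean l.
  by rewrite !mul_mean /psum [in RHS]big_nat_recr //= addrAC subrr add0r.
have -> : u%:R * l%:R * (wilkinson_step R l - (mean l - mean l.+1))
    = u%:R / 2 * ln l.+1%:R - u%:R * l%:R * (mean l - mean l.+1).
  rewrite mulrBr; congr (_ - _); rewrite /wilkinson_step.
  (* At index 0 the Wilkinson step divides by zero, but both sides vanish. *)
  case: l {ul kR} => [|l]; first by rewrite ln1 !(mulr0, mul0r).
  have : l.+1%:R != 0 :> R by rewrite pnatr_eq0.
  by move: (ln _) (l.+1%:R) => x y y0; field.
rewrite -[l.+1%:R]natr1 in kR *; rewrite {}kR.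
move: (mean _) (mean _) (mean _) (\sum_(_ <= j < _) _) => x y z w.
lra.
Qed.

(** For [u = l = j.+1] the window is empty and the logarithms cancel. *)
Lemma deficit_ge0 j : (0 < j < m)%N -> 0 <= deficit j.
Proof.
move=> jm; have := @deficit_ineq j.+1 j.+1.
have -> : (2 * j.+1 - j.+1 = j.+1)%N by lia.
rewrite !big_geq // => /(_ _ _)/=; rewrite leqnn => /(_ isT) => /(_ ltac:(lia)).
have -> : j.+1%:R * 0 + j.+1%:R / 2 * ln j.+1%:R - j.+1%:R * ln j.+1%:R +
  j.+1%:R / 2 * ln j.+1%:R = 0 :> R by field.
rewrite mulr0 add0r pmulr_rge0 // mulr_gt0 ?ltr0n //; lia.
Qed.

(** The case [u = l = m] gives [mean m <= q m + ln m / 2], and [mean 1 - mean m] telescopes. *)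
Lemma pivot_ratio_le : (0 < m)%N ->
  q 1%N - q m <= \sum_(1 <= j < m) wilkinson_step R j + ln m%:R / 2
     - \sum_(1 <= j < m) deficit j.
Proof.
move=> m0; rewrite sum_deficit //.
have -> : mean 1 = q 1%N by rewrite /mean /psum big_nat1 divr1.
have mR : 0 < m%:R :> R by rewrite ltr0n.
have := @qP m m; have -> : (2 * m - m = m)%N by lia.
rewrite m0 leqnn => /(_ isT isT); rewrite -mul_mean => h.
have : m%:R * mean m <= m%:R * (q m + ln m%:R / 2) by lra.
by rewrite ler_pM2l //; lra.
Qed.

End Deficit.

(** * Gain over Wilkinson's bound *)

Section Windows.
Variable R : realType.

(** The tangent at 160 turns thresholds on [ln x] into lower bounds on [x]. *)
Lemma ge_of_ln (x : R) : 0 < x -> 160 * (ln x - 41 / 10) <= x.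
Proof.
move=> x0; have := @ln_le_tangent R 160 x ltac:(lra) x0.
have -> : 160 = 2 ^+ 5 * 5 :> R by field.
rewrite lnM ?posrE ?lnXn ?exprn_gt0 //; try lra.
by have := ln2_le R; have := ln5_le R; lra.
Qed.

(* [x], [y], [z] stand for the logarithms of [l], [k], [u].  With [k ~ 9 l / 5]
   and [a = ln (9 / 5)], twice the right-hand side divided by [l] is about
   [(9 / 5 a - 4 / 5) x + 9 / 10 a ^ 2 - ln 5], which the left-hand side
   rounds down to [x / 4 - 13 / 10], nonnegative from [x = 26 / 5] on. *)
Lemma window_gain_real (l u k x y z : R) :
  160 * (x - 41 / 10) <= l -> 26 / 5 <= x ->
  l <= 5 * u -> 5 * u <= l + 4 -> k = 2 * l - u ->
  x + ln (9 / 5) - (9 * l / 5 - k) / k <= y ->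
  x - ln 5 <= z ->
  l / 2 * ((l + 4) / (l - 1)) * (x / 4 - 13 / 10)
    <= k * ((y ^+ 2 - x ^+ 2) / 4) + u / 2 * x - l * x + l / 2 * z.
Proof.
move=> lx x52 ul lu kE ky zx.
have l0 : 0 < l by lra.
have l1 : 176 <= l by lra.
have k0 : 0 < k by lra.
have l0' := ltW l0; have k0' := ltW k0.
have kl : k <= 9 / 5 * l by lra.
pose a : R := 587 / 1000; have aE : a = 587 / 1000 by []; clearbody a.
(* A lower bound for [y - x]: the term [9 / 20 / l] absorbs the rounding of [u]. *)
pose b := a - 9 / 20 / l.
have bl : b * l = a * l - 9 / 20 by rewrite /b; field; rewrite gt_eqF.
have b1 : b <= a by rewrite /b gerBl divr_ge0 ?ltW.
have b0 : 0 <= b by rewrite -(pmulr_lge0 _ l0) bl aE; lra.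
have yb : x + b <= y.
  apply: le_trans ky; rewrite /b.
  have : (9 * l / 5 - k) / k <= 9 / 20 / l.
    rewrite ler_pdivrMr // [leRHS]mulrAC ler_pdivlMr //.
    apply: (@le_trans _ _ (4 / 5 * l)); last by lra.
    by rewrite ler_wpM2r //; lra.
  by have := ln95_ge R; lra.
clearbody b; clear ky.
have sq : (x + b) ^+ 2 <= y ^+ 2 by rewrite ler_sqr ?nnegrE //; lra.
have lz : l / 2 * (x - 1611 / 1000) <= l / 2 * z.
  by rewrite ler_wpM2l //; have := ln5_le R; lra.
clear zx ul lu.
have ksq : k * (((x + b) ^+ 2 - x ^+ 2) / 4) <= k * ((y ^+ 2 - x ^+ 2) / 4).
  by rewrite ler_wpM2l //; lra.
have b2l : 2 * a * (b * l) - a ^+ 2 * l <= b ^+ 2 * l.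
  rewrite -subr_ge0.
  have -> : b ^+ 2 * l - (2 * a * (b * l) - a ^+ 2 * l) = (b - a) ^+ 2 * l by ring.
  by rewrite mulr_ge0 ?sqr_ge0.
(* Since [u / 2 - l = - k / 2], the terms in [k] share a nonpositive factor, so [k] may be replaced
   by its upper bound. *)
have kk : (9 / 5 * l) * (b * x / 2 + b ^+ 2 / 4 - x / 2)
    <= k * (b * x / 2 + b ^+ 2 / 4 - x / 2).
  rewrite ler_wnM2r //; have : b * x <= a * x by rewrite ler_wpM2r //; lra.
  have : b ^+ 2 <= b by rewrite expr2 -[leRHS]mulr1 ler_wpM2l //; lra.
  by rewrite aE; lra.
have xbl : x * (b * l) = x * (a * l - 9 / 20) by rewrite bl.
have f : (l + 4) / (l - 1) * (x / 4 - 13 / 10)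
    <= x / 4 - 13 / 10 + 126 / 100 * (x - 26 / 5) / l.
  have -> : (l + 4) / (l - 1) = 1 + 5 / (l - 1) by field; rewrite gt_eqF //; lra.
  have : 5 / (l - 1) <= 126 / 25 / l.
    rewrite ler_pdivrMr; last by lra.
    by rewrite [leRHS]mulrAC ler_pdivlMr //; lra.
  move=> h; have : 5 / (l - 1) * (x / 4 - 13 / 10) <= 126 / 25 / l * (x / 4 - 13 / 10).
    by rewrite ler_wpM2r //; lra.
  by move: (5 / (l - 1)) (l^-1) => i j; lra.
have f' : l / 2 * ((l + 4) / (l - 1)) * (x / 4 - 13 / 10) <=
   l / 2 * (x / 4 - 13 / 10) + 63 / 100 * (x - 26 / 5).
  rewrite -mulrA; apply: (le_trans (ler_wpM2l _ f)); first by lra.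
  by rewrite le_eqVlt; apply/orP; left; apply/eqP; field; rewrite gt_eqF.
apply: (le_trans f').
rewrite bl in b2l.
(* [c * l] fits in the slack from rounding the main term down to [x / 4 - 13 / 10], and pays for the
   terms without a factor [l]. *)
pose c := 15 / 1000 + 3 / 1000 * (x - 26/5).
have lxx : c * (160 * (x - 41 / 10)) <= c * l by rewrite ler_wpM2l // /c; lra.
rewrite /c aE in lxx kk b2l xbl *.
have kx : k * x = 2 * l * x - u * x by rewrite kE; ring.
have t2 : 0 <= (x - 26 / 5) ^+ 2 by rewrite sqr_ge0.
have xl : 0 <= (x - 26 / 5) * l by rewrite mulr_ge0 // subr_ge0.
move: lxx kk b2l xbl ksq lz x52 kx t2 xl l0; clear; lra.
Qed.

(* The inequalities [pivot_ineq] are used with [u] the ceiling of [l / 5]. *)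
Definition wcut (l : nat) : nat := ((l + 4) %/ 5)%N.
Definition wend (l : nat) : nat := (2 * l - wcut l)%N.

Lemma wcut_bounds l : (l <= 5 * wcut l <= l + 4)%N.
Proof. by rewrite /wcut; lia. Qed.

Lemma wend_natr l : (wend l)%:R = 2 * l%:R - (wcut l)%:R :> R.
Proof. by rewrite natrB ?natrM //; have := wcut_bounds l; lia. Qed.

Lemma wcut_natr l : (l%:R <= 5 * (wcut l)%:R :> R) && (5 * (wcut l)%:R <= l%:R + 4 :> R).
Proof.
have := wcut_bounds l; rewrite -(ler_nat R) -[(_ <= l + 4)%N](ler_nat R).
by rewrite natrM natrD.
Qed.

(** The factor [(l + 4) / (l - 1)] anticipates the later division by [l * (l + 4)], which leaves the
    denominator [2 * (l - 1)]. *)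
Lemma window_gain (l : nat) : (0 < l)%N -> 26 / 5 <= ln l%:R :> R ->
  l%:R / 2 * ((l%:R + 4) / (l%:R - 1)) * (ln l%:R / 4 - 13 / 10)
    <= (wend l)%:R * \sum_(l <= j < wend l) wilkinson_step R j
       + (wcut l)%:R / 2 * ln l%:R - l%:R * ln l%:R + l%:R / 2 * ln (wcut l)%:R.
Proof.
move=> l0 x52.
have lR : 0 < l%:R :> R by rewrite ltr0n.
have /andP[u1 u2] := wcut_natr l.
have uR : 0 < (wcut l)%:R :> R by lra.
have kE := wend_natr l.
have lx := ge_of_ln lR.
have kR : 0 < (wend l)%:R :> R by rewrite kE; lra.
have lk : (l <= wend l)%N by rewrite /wend; have := wcut_bounds l; lia.
have h1 : ln l%:R + ln (9 / 5) - (9 * l%:R / 5 - (wend l)%:R) / (wend l)%:R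
    <= ln (wend l)%:R :> R.
  rewrite lerBlDr -lnM ?posrE ?divr_gt0 //.
  have -> : l%:R * (9 / 5) = 9 * l%:R / 5 :> R by ring.
  by apply: ln_le_tangent => //; lra.
have h2 : ln l%:R - ln 5 <= ln (wcut l)%:R :> R.
  by rewrite -ln_div ?posrE // ler_ln ?posrE ?divr_gt0 // ler_pdivrMr //; lra.
apply: le_trans (window_gain_real _ x52 u1 u2 kE h1 h2) _; first by lra.
rewrite !lerD2r ler_wpM2l ?(ltW kR) //.
exact: sum_wilkinson_step_ge.
Qed.

(** As [1 / (l - 1)] is at least [ln l - ln (l - 1)], the sum dominates the integral of
    [(x - 26 / 5) / 8] in [x = ln l]. *)
Lemma sum_window_gain_ge (N : nat) : (0 < N)%N -> 26 / 5 <= ln N%:R :> R ->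
  (ln N%:R - 26 / 5) ^+ 2 / 16 <=
   \sum_(2 <= l < N.+1 | 26 / 5 <= ln l%:R :> R)
      (ln l%:R / 4 - 13 / 10) / (2 * (l%:R - 1)) :> R.
Proof.
have nneg N' : 0 <= \sum_(2 <= l < N'.+1 | 26 / 5 <= ln l%:R :> R)
      (ln l%:R / 4 - 13 / 10) / (2 * (l%:R - 1)) :> R.
  rewrite big_nat_cond sumr_ge0 // => l /andP[/andP[l2 _] lx].
  have : 2 <= l%:R :> R by rewrite ler_nat.
  by move=> lR; rewrite divr_ge0 //; lra.
elim: N => // -[|n] IH _; first by rewrite ln1; lra.
move=> x52; rewrite big_mkcond big_nat_recr //= -big_mkcond x52.
have d := @ln_nat_succ_le R n.+1 isT.
have -> : n.+2%:R - 1 = n.+1%:R :> R by rewrite -[n.+2%:R]natr1 addrK.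
have i0 : 0 < n.+1%:R^-1 :> R by rewrite invr_gt0 ltr0n.
have step : (ln n.+2%:R - ln n.+1%:R) * (ln n.+2%:R / 4 - 13 / 10) / 2 <=
    (ln n.+2%:R / 4 - 13 / 10) / (2 * n.+1%:R) :> R.
  have := ler_wpM2r (_ : 0 <= ln n.+2%:R / 4 - 13 / 10 :> R) d.
  rewrite invfM => /(_ ltac:(lra)); move: (n.+1%:R^-1) => i; lra.
have mono : ln n.+1%:R <= ln n.+2%:R :> R.
  by rewrite ler_ln ?posrE ?ltr0n // ler_nat.
have [x52'|x52'] := lerP (26 / 5) (ln n.+1%:R : R).
  have := IH isT x52'; move: step mono.
  move: (ln n.+1%:R) (ln n.+2%:R) (\sum_(_ <= _ < _ | _) _) => x y z; clear.
  move: (_ / (2 * _)) => w s1 s2 s3.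
  by have := sqr_ge0 (x - y); lra.
move: step (nneg n.+1) x52 x52' mono.
move: (ln n.+1%:R) (ln n.+2%:R) (\sum_(_ <= _ < _ | _) _) => x y z; clear.
move: (_ / (2 * _)) => w s1 s2 s3 s4 s5.
have : 0 <= (y - 26 / 5) * (26 / 5 - x) by rewrite mulr_ge0 //; lra.
have := sqr_ge0 (y - 26 / 5).
by lra.
Qed.

(** The windows containing [j] start between about [5 * j / 9] and [j], where the sum is at most a
    difference of logarithms. *)
Lemma window_cover (N j : nat) :
  \sum_(2 <= l < N | (l <= j < wend l)%N) (l%:R + 4)^-1 <= ln (9 / 5) :> R.
Proof.
(* [wend l] is [9 * l / 5] rounded down, so [j < wend l] forces [l] to be at least [5 * (j + 1) / 9]
   rounded up. *)
pose s := ((5 * j + 13) %/ 9)%N.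
apply: (@le_trans _ _ (\sum_(s <= l < j.+1) (l%:R + 4)^-1)).
  apply: ler_sum_nat_sub => [l /andP[l2 _]|l _]; last first.
    by rewrite invr_ge0 -natrD ler0n.
  by rewrite /wend /s; have := wcut_bounds l; lia.
have [sj|js] := leqP s j.+1; last first.
  by rewrite big_geq ?(ltnW js) // ln_ge0 //; lra.
apply: (@le_trans _ _ (\sum_(s <= l < j.+1) (ln (l + 4)%:R - ln (l + 3)%:R))).
  apply: ler_sum => l _; rewrite -natrD (addnS l 3).
  by apply: ln_nat_succ_ge; rewrite addnS.
under eq_bigr => l _ do rewrite (addnS l 3) -addSn.
have sR : 0 < (s + 3)%:R :> R by rewrite ltr0n addnS.
have jR : 0 < (j.+1 + 3)%:R :> R by rewrite ltr0n addnS.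
rewrite (telescope_sumr (fun l => ln (l + 3)%:R)) // -ln_div ?posrE //.
rewrite ler_ln ?posrE ?divr_gt0 // ler_pdivrMr //.
have : (5 * (j.+1 + 3) <= 9 * (s + 3))%N by rewrite /s; lia.
by rewrite -(ler_nat R) !natrM; lra.
Qed.

End Windows.

(** A rational just below the constant, about 0.2078, makes the target a rational polynomial in
    [ln m]. *)
Lemma exponent_ge (R : realType) :
  27 / 130 <= (2 * (2 + (2 - Num.sqrt 2) * ln 2))^-1 :> R.
Proof.
have s0 := sqrtr_ge0 (2 : R).
have ss : Num.sqrt 2 ^+ 2 = 2 :> R by rewrite sqr_sqrtr.
move: (Num.sqrt 2) s0 ss => s s0 ss; have := ln2_le R; have := ln2_ge R.
move: (ln 2) => t t1 t2.
(* 41/29 is a continued fraction convergent of the square root of 2. *)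
have s1 : 41 / 29 <= s by rewrite leNgt; apply/negP => s1; nra.
have s2 : s <= 2 by rewrite leNgt; apply/negP => s2; nra.
have p' : (2 - s) * t <= (2 - 41 / 29) * (694 / 1000) by rewrite ler_pM //; lra.
have p : 0 <= (2 - s) * t by rewrite mulr_ge0 //; lra.
move: p p'; move: (_ * t) => r p p'.
by rewrite -[leRHS]mul1r ler_pdivlMr; lra.
Qed.

(** The left-hand side is Wilkinson's bound as estimated by [sum_wilkinson_step_le]. *)
Lemma small_ln_bound (R : realType) (m : nat) (L : R) : (1 < m)%N -> L = ln m%:R -> L <= 7 ->
  L ^+ 2 / 4 + 16 / 25 - (L / 4 + 16 / 25) / m%:R + L / 2
    <= 27 / 130 * L ^+ 2 + 91 / 100 * L.
Proof.
move=> m1 LE L7.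
have m0 : 0 < m%:R :> R by rewrite ltr0n; lia.
(* The slack is concave in [L] and positive at [4]. *)
have concave (a : R) : a <= 3 -> a <= L -> L <= 4 ->
    0 <= m%:R * (41 / 100 * a - 11 / 260 * a ^+ 2 - 16 / 25) + a / 4 + 16 / 25 ->
  L ^+ 2 / 4 + 16 / 25 - (L / 4 + 16 / 25) / m%:R + L / 2
    <= 27 / 130 * L ^+ 2 + 91 / 100 * L.
  move=> a3 aL L4 ha.
  have Q : 0 <= m%:R * (41 / 100 * L - 11 / 260 * L ^+ 2 - 16 / 25) + L / 4 + 16 / 25.
    have a4 : 0 < 4 - a by lra.
    rewrite -(pmulr_lge0 _ a4).
    have -> : (m%:R * (41 / 100 * L - 11 / 260 * L ^+ 2 - 16 / 25) + L / 4 + 16 / 25) * (4 - a)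
      = (m%:R * (41 / 100 * a - 11 / 260 * a ^+ 2 - 16 / 25) + a / 4 + 16 / 25) * (4 - L)
      + (m%:R * (41 / 100 * 4 - 11 / 260 * 4 ^+ 2 - 16 / 25) + 4 / 4 + 16 / 25) * (L - a)
      + m%:R * (11 / 260) * ((L - a) * (4 - L) * (4 - a)) by field.
    have L4' : 0 <= 4 - L by lra.
    have La : 0 <= L - a by lra.
    have P1 := mulr_ge0 ha L4'.
    have P2 : 0 <= m%:R * (41 / 100 * 4 - 11 / 260 * 4 ^+ 2 - 16 / 25) + 4 / 4 + 16 / 25 :> R.
      by move: m0; lra.
    have P3 := mulr_ge0 (mulr_ge0 La L4') (ltW a4).
    have P4 : 0 <= m%:R * (11 / 260) :> R by apply: mulr_ge0; lra.
    exact: addr_ge0 (addr_ge0 P1 (mulr_ge0 P2 La)) (mulr_ge0 P4 P3).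
  have : (L / 4 + 16 / 25) / m%:R >= 16 / 25 - 41 / 100 * L + 11 / 260 * L ^+ 2.
    by rewrite ler_pdivlMr //; lra.
  by move: (_ / m%:R) => w; lra.
(* For [m >= 8], [L] exceeds 2; the slack without its term in 1/m is concave and nonnegative at 2
   and 7. *)
have [m8|] := leqP 8 m.
  have : ln (2 ^+ 3) <= L.
    rewrite LE ler_ln ?posrE ?exprn_gt0 ?ltr0n //; last by lia.
    by rewrite -natrX ler_nat.
  rewrite lnXn // => h; have := ln2_ge R => l2.
  have i0 : 0 <= (L / 4 + 16 / 25) / m%:R by rewrite divr_ge0 //; lra.
  have : 0 <= (L - 2) * (7 - L) by rewrite mulr_ge0 //; lra.
  by move: i0; move: (_ / m%:R) => w; lra.
move=> m8.
have L4 : L <= 4.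
  apply: (@le_trans _ _ (ln (2 ^+ 3))).
    by rewrite LE ler_ln ?posrE ?exprn_gt0 // -natrX ler_nat ltnW.
  by rewrite lnXn //; have := ln2_le R; lra.
have lower (a : R) : a * (m%:R * m%:R + 4 * m%:R + 1) <= 3 * (m%:R * m%:R - 1) -> a <= L.
  by move=> h; rewrite LE; apply: ln_lower => //; rewrite ler1n ltnW.
have : [|| m == 2, m == 3, m == 4, m == 5, m == 6 | m == 7]%N by lia.
clear LE m8 m1.
case/or4P => [| | |/or3P[| |]] /eqP mE; rewrite mE in concave lower *.
(* Each left end is the Padé lower bound for [ln m], rounded down from [m = 5] on. *)
- by apply: (concave (9 / 13)); [lra | apply: lower; lra | lra | lra].
- by apply: (concave (12 / 11)); [lra | apply: lower; lra | lra | lra].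
- by apply: (concave (45 / 33)); [lra | apply: lower; lra | lra | lra].
- by apply: (concave (3 / 2)); [lra | apply: lower; lra | lra | lra].
- by apply: (concave (17 / 10)); [lra | apply: lower; lra | lra | lra].
- by apply: (concave (18 / 10)); [lra | apply: lower; lra | lra | lra].
Qed.

(** * Total deficit and growth of the pivots *)

Section Growth.
Variables (R : realType) (q : nat -> R) (m : nat).
Hypothesis qP : pivot_ineq q m.

Let E := deficit q.
(* The shift by 4 in the weight compensates the rounding of [l / 5], so that the
   total weight of each [E j] stays below [9 / 5 * ln (9 / 5) + 1 / 5]. *)
Let gain (l : nat) : R := (l%:R * (l%:R + 4))^-1 *
  ((wend l)%:R * \sum_(l <= j < wend l) E j + (wcut l)%:R * l.-1%:R * E l.-1).

Lemma gain_ge (l : nat) : (1 < l)%N -> (wend l <= m)%N -> 26 / 5 <= ln l%:R :> R ->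
  (ln l%:R / 4 - 13 / 10) / (2 * (l%:R - 1)) <= gain l.
Proof.
move=> l1 km x52.
have lR : 2 <= l%:R :> R by rewrite ler_nat.
have h : (0 < wcut l <= l)%N by have := wcut_bounds l; lia.
have := le_trans (window_gain (ltnW l1) x52) (deficit_ineq qP h km).
rewrite /gain /wend; move: (_ + _ * _ * _) => S hS.
have l4 : 0 < l%:R * (l%:R + 4) :> R by rewrite mulr_gt0; lra.
rewrite ler_pdivlMl //; apply: le_trans hS.
by rewrite le_eqVlt; apply/orP; left; apply/eqP; field; rewrite gt_eqF //; lra.
Qed.

(** The two coefficients are controlled by [wend l <= 9 / 5 * l] and [5 * wcut l <= l + 4]. *)
Lemma gain_le (l : nat) : (1 < l)%N -> (wend l <= m)%N ->
  gain l <= 9 / 5 * (l%:R + 4)^-1 * \sum_(1 <= j < m | (l <= j < wend l)%N) E j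
            + 1 / 5 * E l.-1.
Proof.
move=> l1 km.
have lR : 2 <= l%:R :> R by rewrite ler_nat.
have /andP[u1 u2] := wcut_natr R l.
have E0 j : (0 < j < m)%N -> 0 <= E j := deficit_ge0 qP (j := j).
have lk : (l <= wend l)%N by rewrite /wend; have := wcut_bounds l; lia.
rewrite /gain mulrDr lerD //; last first.
  have El : 0 <= E l.-1 by apply: E0; have := wcut_bounds l; rewrite /wend in lk km; lia.
  rewrite mulrA ler_wpM2r // mulrC ler_pdivrMr; last by nra.
  have -> : l.-1%:R = l%:R - 1 :> R by rewrite -subn1 natrB // ltnW.
  by nra.
have -> : \sum_(1 <= j < m | (l <= j < wend l)%N) E j = \sum_(l <= j < wend l) E j.
  rewrite [RHS](big_nat_widen l (wend l) m) // [RHS](big_nat_widenl l 1) //=; last by lia.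
  by apply: eq_bigl => j; rewrite ?andbT andbC.
rewrite mulrA ler_wpM2r //.
  rewrite big_nat_cond sumr_ge0 // => j /andP[/andP[lj jk] _]; apply: E0; lia.
have i4 : 0 <= (l%:R + 4)^-1 :> R by rewrite invr_ge0; lra.
rewrite wend_natr invfM mulrAC ler_wpM2r //.
by rewrite mulrC ler_pdivrMr; lra.
Qed.

(** Windows starting up to [N] end by [m]. Exchanging the sums, [window_cover] bounds the total
    weight of each deficit. *)
Lemma sum_deficit_ge (N : nat) : (0 < N)%N -> (9 * N <= 5 * m)%N ->
  26 / 5 <= ln N%:R :> R ->
  (ln N%:R - 26 / 5) ^+ 2 / 16
    <= (9 / 5 * ln (9 / 5) + 1 / 5) * \sum_(1 <= j < m) E j.
Proof.
move=> N0 Nm x52.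
have E0 j : (0 < j < m)%N -> 0 <= E j := deficit_ge0 qP (j := j).
have km l : (l <= N)%N -> (wend l <= m)%N.
  by rewrite /wend; have := wcut_bounds l; lia.
apply: le_trans (sum_window_gain_ge N0 x52) _.
apply: (@le_trans _ _ (\sum_(2 <= l < N.+1)
   (9 / 5 * (l%:R + 4)^-1 * \sum_(1 <= j < m | (l <= j < wend l)%N) E j
            + 1 / 5 * E l.-1))).
  apply: (@le_trans _ _ (\sum_(2 <= l < N.+1 | 26 / 5 <= ln l%:R :> R)
   (9 / 5 * (l%:R + 4)^-1 * \sum_(1 <= j < m | (l <= j < wend l)%N) E j
            + 1 / 5 * E l.-1))).
    rewrite big_nat_cond [leRHS]big_nat_cond; apply: ler_sum => l /andP[/andP[l2 lN] lx].
    exact: le_trans (gain_ge l2 (km _ lN) lx) (gain_le l2 (km _ lN)).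
  apply: ler_sum_nat_sub => // l /andP[l2 lN].
  have lR : 2 <= l%:R :> R by rewrite ler_nat.
  have i4 : 0 <= (l%:R + 4)^-1 :> R by rewrite invr_ge0; lra.
  have Es : 0 <= \sum_(1 <= j < m | (l <= j < wend l)%N) E j.
    by rewrite big_nat_cond sumr_ge0 // => j /andP[? _]; apply: E0.
  have El : 0 <= E l.-1 by apply: E0; lia.
  by rewrite addr_ge0 // !mulr_ge0 //; lra.
rewrite big_split /= [leRHS]mulrDl lerD //; last first.
  rewrite -mulr_sumr ler_wpM2l ?divr_ge0 //.
  rewrite [leLHS]big_add1 /=.
  by apply: (@ler_sum_nat_sub R 1 N 1 m xpredT E) => [j|j]; [lia | exact: E0].
under eq_bigr => l _ do rewrite mulr_sumr big_mkcond /=.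
rewrite exchange_big_nat /= mulr_sumr big_nat_cond [leRHS]big_nat_cond.
apply: ler_sum => j /andP[jm _].
rewrite -big_mkcond /= -mulr_suml ler_wpM2r ?E0 // -mulr_sumr ler_wpM2l ?divr_ge0 //.
exact: window_cover.
Qed.

Lemma pivot_growth : (0 < m)%N ->
  q 1%N - q m <= ln m%:R * (ln m%:R / (2 * (2 + (2 - Num.sqrt 2) * ln 2)) + 91 / 100).
Proof.
move=> m0; pose c : R := (2 * (2 + (2 - Num.sqrt 2) * ln 2))^-1.
have cge : 27 / 130 <= c := exponent_ge R; rewrite -/c; clearbody c.
have [m1|m1] := leqP m 1.
  have -> : m = 1%N by lia.
  by rewrite subrr ln1 mul0r.
have h1 := pivot_ratio_le qP m0.
have h2 := @sum_wilkinson_step_le R m m0.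
have E0 j : (0 < j < m)%N -> 0 <= E j := deficit_ge0 qP (j := j).
have L0 := @ln_nat_ge0 R m.
have cL : 27 / 130 * ln m%:R ^+ 2 <= c * ln m%:R ^+ 2.
  by rewrite ler_wpM2r // sqr_ge0.
suff : ln m%:R ^+ 2 / 4 + 16 / 25 - (ln m%:R / 4 + 16 / 25) / m%:R + ln m%:R / 2
   - \sum_(1 <= j < m) E j <= 27 / 130 * ln m%:R ^+ 2 + 91 / 100 * ln m%:R.
  move: h1 h2 cL; rewrite -/E; move: (ln m%:R) => L h1 h2 cL h3.
  by apply: le_trans h1 _; lra.
have [L7|L7] := lerP (ln m%:R) (7 : R).
  have := small_ln_bound m1 erefl L7.
  have : 0 <= \sum_(1 <= j < m) E j.
    by rewrite big_nat_cond sumr_ge0 // => j /andP[jm _]; apply: E0.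
  by lra.
have mR : 0 < m%:R :> R by rewrite ltr0n.
have m464 : 464 <= m%:R :> R by have := ge_of_ln mR; lra.
(* Restricting to windows that end by [m] costs about [ln (9 / 5)], less than 6/10, in the
   logarithm. *)
have [N [N1 N2]] : exists N, (9 * N <= 5 * m /\ 5 * m <= 9 * N + 8)%N.
  by exists ((5 * m) %/ 9)%N; clear; lia.
have N2R : 5 * m%:R <= 9 * N%:R + 8 :> R by rewrite -!natrM -natrD ler_nat.
have NR : 256 < N%:R :> R by lra.
have N0 : (0 < N)%N by rewrite -(ltr_nat R); lra.
have NL : ln m%:R - 6 / 10 <= ln N%:R :> R.
  have : ln (m%:R / (9 / 5)) <= ln N%:R + (m%:R / (9 / 5) - N%:R) / N%:R :> R.
    by apply: ln_le_tangent; lra.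
  rewrite ln_div ?posrE ?divr_gt0 //.
  have : (m%:R / (9 / 5) - N%:R) / N%:R <= 4 / 1000 :> R.
    by rewrite ler_pdivrMr; lra.
  by have := ln95_le R; lra.
have := sum_deficit_ge N0 N1; have := ln95_le R.
have : 0 <= \sum_(1 <= j < m) E j.
  by rewrite big_nat_cond sumr_ge0 // => j /andP[jm _]; apply: E0.
have : 0 <= (ln m%:R / 4 + 16 / 25) / m%:R :> R by rewrite divr_ge0 //; lra.
move: (\sum_(1 <= j < m) _) (ln m%:R) (ln N%:R) (ln (9 / 5)) (_ / m%:R) L7 NL
  => S L X a w; clear => L7 NL w0 S0 a1 /(_ ltac:(lra)) h.
have h1 : (L - 58 / 10) ^+ 2 <= (X - 26 / 5) ^+ 2.
  by rewrite ler_sqr ?nnegrE //; lra.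
(* 126/100 is [9 / 5 * (53 / 90) + 1 / 5]. *)
have h2 : (9 / 5 * a + 1 / 5) * S <= 126 / 100 * S by rewrite ler_wpM2r //; lra.
(* The remaining quadratic in [L] has its minimum near 57/5. *)
have h3 := sqr_ge0 (L - 57 / 5).
by lra.
Qed.
End Growth.

(** * Determinants of matrices with small restrictions *)

Section Hadamard.
Local Open Scope sesquilinear_scope.
Variable C : numClosedFieldType.

Lemma norm_det_unitary n (U : 'M[C]_n) : U \is unitarymx -> `|\det U| = 1.
Proof.
move=> /unitarymxP /(congr1 determinant); rewrite det_mulmx det1 det_map_mx det_tr.
by rewrite -normCK => /eqP; rewrite sqrp_eq1 ?normr_ge0 // => /eqP.
Qed.

(** Row [i] of [A] lies in the span of the orthonormal rows of [schmidt A] up to index [i]. *)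
Lemma schmidt_trig n (A : 'M[C]_n) (i j : 'I_n) :
  (i < j)%N -> (A *m (schmidt A)^t*) i j = 0.
Proof.
move=> ij; set Q := schmidt A.
have /unitarymxP QQ : Q \is unitarymx by exact: schmidt_unitarymx.
have sub : (row i A <= kermx (col j (Q^t*)))%MS.
  apply: submx_trans (row_schmidt_sub A i) _; apply/sumsmx_subP => k ki.
  rewrite genmxE; apply/sub_kermxP; rewrite -/Q; apply/matrixP => a b.
  have -> : (row k Q *m col j (Q^t*)) a b = (Q *m Q^t*) k j.
    by rewrite !mxE; apply: eq_bigr => c _; rewrite !mxE.
  rewrite QQ !mxE; case: eqP => // kj.
  by move: ki; rewrite kj leqNgt ij.
have -> : (A *m Q^t*) i j = (row i A *m col j (Q^t*)) 0 0.
  by rewrite !mxE; apply: eq_bigr => k _; rewrite !mxE.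
by rewrite (sub_kermxP sub) mxE.
Qed.

Lemma sum_norm_unitary m n (A : 'M[C]_(m, n)) (U : 'M[C]_n) i :
  U \is unitarymx ->
  \sum_j `|(A *m U^t*) i j| ^+ 2 = \sum_j `|A i j| ^+ 2.
Proof.
move=> Uu; have dotE p (B : 'M[C]_(m, p)) : \sum_j `|B i j| ^+ 2 = (B *m B^t*) i i.
  by rewrite mxE; apply: eq_bigr => j _; rewrite !mxE normCK.
rewrite !dotE trmx_mul map_mxM /= mulmxA.
have -> : map_mx Num.conj (U^t*)^T = U.
  by apply/matrixP => a b; rewrite !mxE conjCK.
by rewrite mulmxKtV.
Qed.

(** In the Gram-Schmidt basis the matrix is triangular, with the same row norms. *)
Lemma hadamard n (B : 'M[C]_n) :
  `|\det B| ^+ 2 <= \prod_i \sum_j `|B i j| ^+ 2.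
Proof.
set Q := schmidt B; have Qu : Q \is unitarymx by exact: schmidt_unitarymx.
have Qu' : Q^t* \is unitarymx by rewrite trmxC_unitary.
have -> : `|\det B| = `|\det (B *m Q^t*)|.
  by rewrite det_mulmx normrM (norm_det_unitary Qu') mulr1.
rewrite det_trig; last first.
  by apply/is_trig_mxP => i j ij; rewrite schmidt_trig.
rewrite normr_prod -prodrXl; apply: ler_prod => i _.
rewrite exprn_ge0 //= -(sum_norm_unitary B i Qu) (bigD1 i) //= lerDl.
by rewrite sumr_ge0 // => j _; rewrite exprn_ge0.
Qed.

End Hadamard.

Section DetTail.
Local Open Scope sesquilinear_scope.
Variable R : realType.
Local Notation nrm := (@Normc.normc R).

(* [X] plays the role of the pivot rows: on the orthogonal complement of its
   first [s] rows [T] agrees with the small matrix [M s].  An orthonormal basis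
   adapted to this flag replaces the singular vectors of [T]. *)
Lemma det_flag_bound l (T X : 'M[R[i]]_l) (v : nat) (M : nat -> 'M[R[i]]_l) :
  (forall s, (s <= v)%N -> forall w : 'cV[R[i]]_l,
     (forall i : 'I_l, (i < s)%N -> (X *m w) i 0 = 0) -> T *m w = M s *m w) ->
  exists a : 'I_l -> R, [/\ forall i, 0 <= a i,
    nrm (\det T) ^+ 2 <= \prod_i a i &
    forall s, (s <= v)%N ->
      \sum_(i < l | (s <= i)%N) a i <= \sum_i \sum_j nrm (M s i j) ^+ 2].
Proof.
move=> TM; set Q := schmidt X.
have Qu : Q \is unitarymx by exact: schmidt_unitarymx.
have Qu' : Q^t* \is unitarymx by rewrite trmxC_unitary.
exists (fun i => \sum_j nrm ((T *m Q^t*) j i) ^+ 2); split.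
- by move=> i; rewrite sumr_ge0 // => j _; rewrite sqr_ge0.
- rewrite -lecR rmorphXn rmorph_prod /=.
  have := hadamard (T *m Q^t*)^T.
  rewrite det_tr det_mulmx normrM (norm_det_unitary Qu') mulr1.
  congr (_ <= _); apply: eq_bigr => i _; rewrite rmorph_sum; apply: eq_bigr => j _.
  by rewrite mxE rmorphXn.
move=> s sv.
apply: (@le_trans _ _ (\sum_i \sum_j nrm ((M s *m Q^t*) j i) ^+ 2)).
  rewrite [leRHS](bigID (fun i : 'I_l => (s <= i)%N)) /=.
  rewrite -[leLHS]addr0 lerD //; last first.
    by rewrite sumr_ge0 // => i _; rewrite sumr_ge0 // => j _; rewrite sqr_ge0.
  apply: ler_sum => i si; apply: ler_sum => j _.
  (* For [i >= s] the basis vector is orthogonal to the first [s] rows of [X]. *)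
  have e : T *m col i (Q^t*) = M s *m col i (Q^t*).
    apply: TM => // k ks.
    have := schmidt_trig X (leq_trans ks si : (k < i)%N); rewrite -/Q => <-.
    by rewrite !mxE; apply: eq_bigr => b _; rewrite !mxE.
  have -> : (T *m Q^t*) j i = (M s *m Q^t*) j i; last by [].
  have /matrixP/(_ j 0) := e; rewrite !mxE => h.
  transitivity (\sum_k T j k * col i (Q^t*) k 0).
    by apply: eq_bigr => b _; rewrite !mxE.
  by rewrite h; apply: eq_bigr => b _; rewrite !mxE.
rewrite exchange_big /=; apply: ler_sum => i _; rewrite -lecR !rmorph_sum /=.
have := sum_norm_unitary (M s) i Qu => e.
by under eq_bigr do rewrite rmorphXn; under [leRHS]eq_bigr do rewrite rmorphXn; rewrite e.
Qed.

(* Removing the smallest remaining factor again and again, only the sizes of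
   the tails matter. *)
Lemma prod_tail_bound l (a : 'I_l -> R) (u v : nat) (tau : nat -> R) :
  (0 < u)%N -> l = (u + v)%N -> (forall i, 0 <= a i) ->
  (forall s, (s <= v)%N -> \sum_(i < l | (s <= i)%N) a i <= tau s) ->
  \prod_i a i <= (tau 0%N / u%:R) ^+ u * \prod_(1 <= s < v.+1) (tau s / u%:R).
Proof.
move=> u0 lE a0 tauP.
have uR : 0 < u%:R :> R by rewrite ltr0n.
have tau0 s : (s <= v)%N -> 0 <= tau s.
  by move=> sv; apply: le_trans (tauP s sv); rewrite sumr_ge0.
suff main b (B : {set 'I_l}) : (b <= v)%N -> #|B| = (u + b)%N ->
    \prod_(i in B) a i <= (tau 0%N / u%:R) ^+ u * \prod_(1 <= s < b.+1) (tau s / u%:R).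
  have := main v [set: 'I_l] (leqnn _); rewrite cardsT card_ord => /(_ lE).
  by under eq_bigl do rewrite inE.
elim: b B => [|b IH] B bv cB.
  (* With [u] factors left, the arithmetic-geometric mean inequality applies. *)
  rewrite big_geq // mulr1; have := leif_AGM (A := mem B) (E := a) (fun i _ => a0 i).
  rewrite cB addn0 => -[h _]; apply: le_trans h _.
  rewrite lerXn2r ?nnegrE ?divr_ge0 ?sumr_ge0 ?tau0 // ?ler_wpM2r ?invr_ge0 ?(ltW uR) //.
  apply: le_trans (tauP 0%N _) => //; rewrite [leRHS](bigID (mem B)) /=.
  by rewrite lerDl sumr_ge0.
have [i0 i0B] : exists i0, i0 \in B by apply/card_gt0P; rewrite cB; lia.
have [i iB imin] := arg_minP a i0B.
rewrite big_nat_recr //= mulrA (bigD1 i) //= mulrC.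
apply: ler_pM => //; first by rewrite prodr_ge0.
  have cB' : #|B :\ i| = (u + b)%N.
    by have := cardsD1 i B; rewrite cB (iB : i \in B) addnS add1n => -[].
  have := IH (B :\ i) (ltnW bv) cB'; congr (_ <= _); apply: eq_bigl => j.
  by rewrite !inE andbC.
rewrite ler_pdivlMr //; apply: le_trans (tauP b.+1 bv).
(* At least [u] elements of [B] lie in the tail from [b.+1], each with a value no less than the
   minimum. *)
pose S := B :\: [set j : 'I_l | (j < b.+1)%N].
have cS : (u <= #|S|)%N.
  rewrite cardsD cB.
  have : (#|B :&: [set j : 'I_l | (j < b.+1)%N]| <= b.+1)%N.
    apply: leq_trans (subset_leq_card (subsetIr _ _)) _.
    rewrite -sum1_card (eq_bigl (fun j : 'I_l => (j < b.+1)%N)); last by move=> j; rewrite inE.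
    have bl : (b.+1 <= l)%N by lia.
    by rewrite (big_ord_narrow bl) sum1_card card_ord.
  lia.
apply: (@le_trans _ _ (\sum_(j in S) a i)).
  by rewrite sumr_const -[leRHS]mulr_natr ler_wpM2l // ler_nat.
apply: (@le_trans _ _ (\sum_(j in S) a j)).
  by apply: ler_sum => j; rewrite inE => /andP[_ jB]; exact: imin.
rewrite [leRHS](bigID (mem S)) /= -[leLHS]addr0 lerD ?sumr_ge0 //.
rewrite le_eqVlt; apply/orP; left; apply/eqP; apply: eq_bigl => j.
by rewrite !inE -leqNgt; case: (b < j)%N => //=; rewrite andbF.
Qed.

End DetTail.

(** * Gaussian elimination *)

Section Elimination.
Variable F : fieldType.
Variable A : nat -> nat -> F.

(* [t] steps of elimination, keeping the row and column numbers of [A]. *)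
Fixpoint elim (t i j : nat) : F :=
  if t is s.+1 then elim s i j - elim s i s * elim s s j / elim s s s else A i j.

Lemma det_block_schur l (a : F) (r : 'rV[F]_l) (c : 'cV[F]_l) (D : 'M[F]_l) :
  a != 0 -> \det (block_mx a%:M r c D) = a * \det (D - a^-1 *: (c *m r)).
Proof.
move=> a0.
have -> : block_mx a%:M r c D =
    block_mx 1%:M 0 (a^-1 *: c) 1%:M *m block_mx a%:M r 0 (D - a^-1 *: (c *m r)).
  rewrite mulmx_block !mul1mx !mul0mx !addr0 mul_mx_scalar scalerA mulfV // scale1r.
  by rewrite -scalemxAl addrC subrK.
by rewrite det_mulmx det_lblock det_ublock !det1 !mul1r det_scalar1.
Qed.

(** The Schur complement of the first entry is the next stage of elimination, so the pivots split
    off one by one. *)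
Lemma det_elim (l t : nat) : (forall s, (t <= s < t + l)%N -> elim s s s != 0) ->
  \det (\matrix_(i < l, j < l) elim t (t + i) (t + j)) = \prod_(t <= s < t + l) elim s s s.
Proof.
elim: l t => [|l IH] t nz; first by rewrite det_mx00 big_geq ?addn0.
have t0 : elim t t t != 0 by apply: nz; lia.
set T := \matrix_(i, j) _.
rewrite -[T](@submxK _ 1 l 1 l).
have -> : @ulsubmx _ 1 l 1 l T = (elim t t t)%:M.
  by apply/matrixP => i j; rewrite !ord1 !mxE /= !addn0.
rewrite det_block_schur // big_ltn; last by lia.
congr (_ * _); rewrite -addSnnS -IH; last by move=> s ts; apply: nz; lia.
congr (\det _); apply/matrixP => i j.
rewrite !mxE big_ord1 !mxE /= !add1n !addn0 !addnS !addSn.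
by rewrite [X in _ - X]mulrC.
Qed.

End Elimination.

Lemma sum_nat_reflect (V : nmodType) (g : nat -> V) (l m : nat) : (l <= m)%N ->
  \sum_(m - l <= t < m) g (m - t)%N = \sum_(1 <= i < l.+1) g i.
Proof.
elim: l => [|l IH] lm; first by rewrite subn0 !big_geq.
rewrite big_ltn; last by lia.
have -> : ((m - l.+1).+1 = m - l)%N by lia.
rewrite IH; last by lia.
by rewrite [RHS]big_nat_recr //= addrC subKn.
Qed.

Lemma sum_psum (R : realType) (q : nat -> R) (l v : nat) :
  psum q (l + v) - psum q l = \sum_(1 <= s < v.+1) q (l + s)%N.
Proof.
elim: v => [|v IH]; first by rewrite addn0 subrr big_geq.
by rewrite big_nat_recr //= -IH addnS /psum big_nat_recr //= addrAC.
Qed.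

(** * Inequalities between the pivots *)

Section PivotInequality.
Variables (R : realType) (A : nat -> nat -> R[i]) (m : nat).
Local Notation nrm := (@Normc.normc R).
Local Notation el := (elim A).
Hypothesis piv_neq0 : forall t, (t < m)%N -> el t t t != 0.
Hypothesis piv_max : forall t i j, (t <= i < m)%N -> (t <= j < m)%N ->
  nrm (el t i j) <= nrm (el t t t).

Let p t := nrm (el t t t).

Lemma normc_ge0 (z : R[i]) : 0 <= nrm z.
Proof. by case: z => a b; exact: sqrtr_ge0. Qed.

Lemma piv_gt0 t : (t < m)%N -> 0 < p t.
Proof.
move=> tm; rewrite lt_def normc_ge0 andbT; apply: contra (piv_neq0 tm) => /eqP e.
by apply/eqP; apply: Normc.eq0_normc.
Qed.

(** The block [M s] keeps the last [l] rows and columns [s] steps earlier. [M s] and [M s.+1] differ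
    by a rank one matrix with row [s] of [X], so [M 0] and [M s] agree wherever the first [s] rows
    of [X] vanish. *)
Lemma det_trailing_bound (l u : nat) : (0 < u <= l)%N -> (2 * l - u <= m)%N ->
  \prod_(m - l <= t < m) p t ^+ 2
    <= ((l%:R * p (m - l)) ^+ 2 / u%:R) ^+ u
       * \prod_(1 <= s < (l - u).+1) ((l%:R * p (m - l - s)) ^+ 2 / u%:R).
Proof.
move=> /andP[u0 ul] km; set t0 := (m - l)%N; set v := (l - u)%N.
have vt : (v <= t0)%N by lia.
have tl : (t0 + l = m)%N by lia.
pose M s : 'M[R[i]]_l := \matrix_(i < l, j < l) el (t0 - s) (t0 + i) (t0 + j).
pose X : 'M[R[i]]_l := \matrix_(i < l, j < l) el (t0 - i.+1) (t0 - i.+1) (t0 + j).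
have flag s : (s <= v)%N -> forall w : 'cV[R[i]]_l,
   (forall i : 'I_l, (i < s)%N -> (X *m w) i 0 = 0) -> M 0%N *m w = M s *m w.
  elim: s => // s IH sv w Xw; rewrite IH; first last.
  - by move=> i si; apply: Xw; lia.
  - by lia.
  have sl : (s < l)%N by lia.
  have := Xw (Ordinal sl) (ltnSn _); rewrite mxE => X0.
  apply/matrixP => i j; rewrite !ord1 !mxE.
  have e : (t0 - s = (t0 - s.+1).+1)%N by lia.
  pose c := el (t0 - s.+1) (t0 + i) (t0 - s.+1) /
            el (t0 - s.+1) (t0 - s.+1) (t0 - s.+1).
  transitivity (\sum_k M s.+1 i k * w k 0 - c * \sum_k X (Ordinal sl) k * w k 0).
    rewrite mulr_sumr -sumrB; apply: eq_bigr => k _.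
    by rewrite !mxE e /= /c -/elim; ring.
  by rewrite X0 mulr0 subr0.
have [a [a0 da ta]] := det_flag_bound flag.
have dM : nrm (\det (M 0%N)) ^+ 2 = \prod_(t0 <= t < m) p t ^+ 2.
  have -> : M 0%N = \matrix_(i < l, j < l) el t0 (t0 + i) (t0 + j).
    by apply/matrixP => i j; rewrite !mxE subn0.
  rewrite det_elim; last by move=> s; rewrite tl => ts; apply: piv_neq0; lia.
  rewrite tl prodrXl; congr (_ ^+ 2).
  by elim/big_rec2: _ => [|t x y _ <-]; rewrite ?Normc.normc1 // Normc.normcM.
rewrite -dM; apply: le_trans da _.
have := @prod_tail_bound R l a u v (fun s => (l%:R * p (t0 - s)) ^+ 2) u0.
rewrite subn0; apply => //; first by lia.
move=> s sv; apply: le_trans (ta s sv) _.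
apply: (@le_trans _ _ (\sum_(i < l) \sum_(j < l) p (t0 - s) ^+ 2)).
  apply: ler_sum => i _; apply: ler_sum => j _; rewrite mxE.
  rewrite ler_sqr ?nnegrE ?normc_ge0 //; apply: piv_max.
    by have := ltn_ord i; lia.
  by have := ltn_ord j; lia.
by rewrite !sumr_const card_ord -mulrnA -[leLHS]mulr_natl natrM exprMn [l%:R ^+ 2]expr2.
Qed.

(** Half the logarithm of [det_trailing_bound]; size [k] is reached after [m - k] steps. *)
Lemma pivot_ineq_elim : pivot_ineq (fun k => ln (p (m - k))) m.
Proof.
move=> l u ul km; set q := fun k => ln (p (m - k)).
have /andP[u0 ul'] := ul.
have l0 : 0 < l%:R :> R by rewrite ltr0n; lia.
have uR : 0 < u%:R :> R by rewrite ltr0n.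
have pp k : (0 < k <= m)%N -> 0 < p (m - k) by move=> km'; apply: piv_gt0; lia.
have ln_prod (a b : nat) (f : nat -> R) :
    (forall t, (a <= t < b)%N -> 0 < f t) ->
    0 < \prod_(a <= t < b) f t /\ ln (\prod_(a <= t < b) f t) = \sum_(a <= t < b) ln (f t).
  move=> f0; rewrite big_nat_cond [X in _ = X]big_nat_cond.
  elim/big_rec2: _ => [|t x y /andP[tb _] [y0 <-]]; first by rewrite ln1.
  by rewrite lnM ?posrE ?mulr_gt0 ?f0.
have lnf k : (0 < k <= m)%N ->
    ln ((l%:R * p (m - k)) ^+ 2 / u%:R) = 2 * (ln l%:R + q k) - ln u%:R.
  move=> km'; rewrite ln_div ?posrE ?exprn_gt0 ?mulr_gt0 ?pp //.
  by rewrite lnXn ?mulr_gt0 ?pp // lnM ?posrE ?pp // mulr_natl.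
have f0 k : (0 < k <= m)%N -> 0 < (l%:R * p (m - k)) ^+ 2 / u%:R.
  by move=> km'; rewrite divr_gt0 ?exprn_gt0 ?mulr_gt0 ?pp.
have [P0 P1] := ln_prod (m - l)%N m (fun t => p t ^+ 2) ltac:(
   by move=> t tm; rewrite exprn_gt0 // piv_gt0; lia).
have fs s : (1 <= s < (l - u).+1)%N -> 0 < (l%:R * p (m - l - s)) ^+ 2 / u%:R.
  by move=> sv; rewrite -subnDA; apply: f0; lia.
have [Q0 Q1] := ln_prod _ _ _ fs; cbv beta in P1, Q1.
have fl : 0 < (l%:R * p (m - l)) ^+ 2 / u%:R by apply: f0; lia.
move: (det_trailing_bound ul km); set D := _ * _ => h.
have D0 : 0 < D by rewrite mulr_gt0 ?exprn_gt0.
have lnl := lnf l ltac:(lia).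
have : ln (\prod_(m - l <= t < m) p t ^+ 2) <= ln D by rewrite ler_ln.
have -> : ln D = (2 * (ln l%:R + q l) - ln u%:R) *+ u
    + \sum_(1 <= s < (l - u).+1) ln ((l%:R * p (m - l - s)) ^+ 2 / u%:R).
  by rewrite -Q1 -lnl -lnXn // -lnM // ?posrE ?exprn_gt0.
rewrite P1.
have -> : \sum_(m - l <= t < m) ln (p t ^+ 2) = 2 * psum q l.
  rewrite /psum -(@sum_nat_reflect _ q l m) ?mulr_sumr; last by lia.
  apply: eq_big_nat => t tm; rewrite /q lnXn ?mulr_natl; last by apply: piv_gt0; lia.
  by congr (ln (p _) *+ 2); lia.
have -> : \sum_(1 <= s < (l - u).+1) ln ((l%:R * p (m - l - s)) ^+ 2 / u%:R)
   = \sum_(1 <= s < (l - u).+1) ((2 * ln l%:R - ln u%:R) + 2 * q (l + s)%N).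
  apply: eq_big_nat => s sv; rewrite -subnDA lnf; last by lia.
  by ring.
rewrite big_split /= sumr_const_nat -mulr_sumr -sum_psum subn1 /=.
have -> : (l + (l - u) = 2 * l - u)%N by lia.
rewrite -[_ *+ u]mulr_natl -[_ *+ (l - u)]mulr_natl natrB //.
have ql : q l = ln (p (m - l)) by []; rewrite -ql.
by move: (psum q _) (psum q _) (q l) => x y z; lra.
Qed.
End PivotInequality.

(** * LU decomposition and completely pivoted matrices *)

Section ElimFacts.
Variables (F : fieldType) (A : nat -> nat -> F).
Local Notation el := (elim A).

(** LU decomposition stopped after [t] steps, with remainder [elim t]. *)
Lemma elim_decomp t i j :
  A i j = \sum_(s < t) el s i s / el s s s * el s s j + el t i j.
Proof.
elim: t => [|t IH]; first by rewrite big_ord0 add0r.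
by rewrite big_ord_recr /= {1}IH; ring.
Qed.

(** [elim] updates all indices, so each step clears its pivot row and column, and later steps keep
    them zero. *)
Lemma elim_eq0 t i j : (forall s, (s < t)%N -> el s s s != 0) ->
  (i < t)%N || (j < t)%N -> el t i j = 0.
Proof.
elim: t i j => // t IH i j nz ij /=.
have t0 : el t t t != 0 by apply: nz.
have nz' s : (s < t)%N -> el s s s != 0 by move=> st; apply: nz; lia.
have [->|it] := eqVneq i t; first by field.
have [->|jt] := eqVneq j t; first by field.
have z : (i < t)%N || (j < t)%N by lia.
have -> : el t i t * el t t j = 0; last by rewrite IH // mul0r subr0.
by case/orP: z => h; [rewrite (IH i t) ?h ?mul0r | rewrite (IH t j) ?h ?orbT ?mulr0].
Qed.

End ElimFacts.

Section Bridge.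
Variables (R : realType) (n' : nat).
Local Notation n := n'.+1.
Variable A : 'M[R[i]]_n.
Local Notation nrm := (@Normc.normc R).

Definition entry (i j : nat) : R[i] := A (inord i) (inord j).
Local Notation el := (elim entry).

(** The remainder of the LU decomposition lives in the lower right block only, so the product
    subtracted in [ge_mx] is [L2 *m U2]. *)
Lemma ge_mx_elim k (kn : (k <= n)%N) (i j : 'I_k) :
  ge_defined kn A -> (forall s, (s < n - k)%N -> el s s s != 0) ->
  ge_mx kn A i j = el (n - k) (n - k + i) (n - k + j).
Proof.
rewrite /ge_defined /ge_mx; set B := ge_block kn A; set t := (n - k)%N => Bu nz.
have BE x y : B x y = \sum_(s < t) el s x s / el s s s * el s s y + el t x y.
  rewrite -elim_decomp /B /ge_block castmxE /entry.
  by congr (A _ _); apply/val_inj; rewrite /= inordK //; have := ltn_ord x; have := ltn_ord y; lia.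
pose L1 : 'M_t := \matrix_(x, s) (el s x s / el s s s).
pose L2 : 'M_(k, t) := \matrix_(x, s) (el s (t + x) s / el s s s).
pose U1 : 'M_t := \matrix_(s, y) el s s y.
pose U2 : 'M_(t, k) := \matrix_(s, y) el s s (t + y).
have e11 : ulsubmx B = L1 *m U1.
  apply/matrixP => x y; rewrite !mxE BE /= elim_eq0 ?ltn_ord // addr0.
  by apply: eq_bigr => s _; rewrite !mxE.
have e12 : ursubmx B = L1 *m U2.
  apply/matrixP => x y; rewrite !mxE BE /= elim_eq0 ?ltn_ord // addr0.
  by apply: eq_bigr => s _; rewrite !mxE.
have e21 : dlsubmx B = L2 *m U1.
  apply/matrixP => x y; rewrite !mxE BE /= elim_eq0 ?ltn_ord ?orbT // addr0.
  by apply: eq_bigr => s _; rewrite !mxE.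
have := Bu; rewrite {1}e11 unitmx_mul => /andP[L1u U1u].
have Y : U1 *m (invmx (ulsubmx B) *m ursubmx B) = U2.
  have h : L1 *m (U1 *m (invmx (ulsubmx B) *m ursubmx B)) = ursubmx B.
    by rewrite (mulmxA L1) -e11 mulKVmx.
  by rewrite -[LHS](mulKmx L1u) h e12 mulKmx.
rewrite e21 -!mulmxA Y !mxE BE /= addrAC -[RHS]add0r; congr (_ + _).
by apply/eqP; rewrite subr_eq0; apply/eqP/eq_bigr => s _; rewrite !mxE.
Qed.

Hypothesis cp : completely_pivoted A.

Lemma normc_le_maxnorm p r (M : 'M[R[i]]_(p, r)) i j : nrm (M i j) <= maxnorm M.
Proof.
apply: le_trans (le_bigmax _ _ i).
exact: (le_bigmax _ (fun j => nrm (M i j)) j).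
Qed.

Lemma ge_mx_cp t i j : (t <= i < n)%N -> (t <= j < n)%N ->
  (forall s, (s < t)%N -> el s s s != 0) ->
  nrm (el t i j) <= nrm (el t t t).
Proof.
move=> ti tj nz.
(* The ordinal [n - t.+1] encodes the size [n - t]. *)
have kn : (n - t.+1 < n)%N by lia.
have [_ /(_ (Ordinal kn))] := cp.
have := @ge_mx_elim _ (ltn_ord (Ordinal kn)).
have -> : (n - (Ordinal kn).+1 = t)%N by rewrite /=; lia.
move=> E [/E {}E h].
have {}E x y := E x y nz.
have ik : (i - t < (n - t.+1).+1)%N by lia.
have jk : (j - t < (n - t.+1).+1)%N by lia.
have := normc_le_maxnorm (ge_mx (ltn_ord (Ordinal kn)) A) (Ordinal ik) (Ordinal jk).
by rewrite -h !E /= addn0 !subnKC //; lia.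
Qed.

(** A zero pivot of maximal modulus makes the whole remainder vanish, so [A] would have rank at most
    [t < n]. *)
Lemma pivot_neq0 t : (t < n)%N -> el t t t != 0.
Proof.
elim/ltn_ind: t => t IH tn.
have nz s : (s < t)%N -> el s s s != 0 by move=> st; apply: IH; lia.
apply/eqP => e0.
have z x y : (x < n)%N -> (y < n)%N -> el t x y = 0.
  move=> xn yn; have [xt|tx] := ltnP x t; first by rewrite elim_eq0 ?xt.
  have [yt|ty] := ltnP y t; first by rewrite elim_eq0 ?yt ?orbT.
  apply: Normc.eq0_normc; apply/eqP; rewrite eq_le normc_ge0 andbT.
  have := @ge_mx_cp t x y; rewrite e0 Normc.normc0; apply => //; lia.
have : A = (\matrix_(x < n, s < t) (el s x s / el s s s)) *m (\matrix_(s < t, y < n) el s s y).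
  apply/matrixP => x y; rewrite mxE.
  have -> : A x y = entry x y by rewrite /entry !inord_val.
  rewrite (elim_decomp _ t) z ?ltn_ord // addr0.
  by apply: eq_bigr => s _; rewrite !mxE.
have [Au _] := cp; have := mxrank_unit Au => rA AE; move: rA; rewrite AE => rA.
have := mulmx_max_rank (\matrix_(x < n, s < t) (el s x s / el s s s)) (\matrix_(s < t, y < n) el s s y).
by rewrite rA; lia.
Qed.

(* [pivot_growth] is applied to the leading submatrix of size [t.+1], whose last
   pivot is the one after [t] steps. *)
Lemma growth_le :
  growth A <= n%:R `^ (ln n%:R / (2 * (2 + (2 - Num.sqrt 2) * ln 2)) + 91 / 100).
Proof.
have A00 : el 0%N 0%N 0%N = A ord0 ord0.
  by rewrite /= /entry; congr (A _ _); apply/val_inj; rewrite /= inordK.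
have p0 t : (t < n)%N -> 0 < nrm (el t t t).
  by move=> tn; apply: (@piv_gt0 _ _ n) => // s sn; apply: pivot_neq0.
have P0 := p0 0%N (ltn0Sn _); have leA := normc_le_maxnorm A ord0 ord0.
rewrite -A00 in leA.
have A0 : 0 < maxnorm A by apply: lt_le_trans leA.
set e := (_ / _ + _).
rewrite /growth ler_pdivrMr //; apply: bigmax_le => [|i _].
  by rewrite mulr_ge0 ?powR_ge0 ?ltW.
have [_ /(_ i) [def <-]] := cp.
rewrite ge_mx_elim //; last by move=> s si; apply: pivot_neq0; have := ltn_ord i; lia.
rewrite /= addn0; have tn : (n - i.+1 < n)%N by have := ltn_ord i; lia.
move: (n - i.+1)%N tn => t tn.
apply: (@le_trans _ _ (n%:R `^ e * nrm (el 0%N 0%N 0%N))); last first.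
  by rewrite ler_wpM2l ?powR_ge0.
have nz s : (s < t.+1)%N -> el s s s != 0 by move=> st; apply: pivot_neq0; lia.
have mx s x y : (s <= x < t.+1)%N -> (s <= y < t.+1)%N -> nrm (el s x y) <= nrm (el s s s).
  move=> sx sy; apply: ge_mx_cp; try lia.
  by move=> r rs; apply: pivot_neq0; lia.
(* Here [q 1] belongs to the pivot after [t] steps and [q t.+1] to the first pivot. *)
have := pivot_growth (pivot_ineq_elim nz mx) (ltn0Sn t).
rewrite subn1 subnn /= => h.
have lnle : ln t.+1%:R <= ln n%:R :> R by rewrite ler_ln ?posrE ?ltr0n // ler_nat.
have ln0 := @ln_nat_ge0 R t.+1.
rewrite -ler_ln ?posrE ?mulr_gt0 ?powR_gt0 ?ltr0n ?p0 //.
rewrite lnM ?posrE ?powR_gt0 ?ltr0n // ln_powR -lerBlDr.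
have := exponent_ge R; move: (2 * _) @e h => d e h cge.
have d0 : 0 <= d^-1 by apply: le_trans cge; rewrite divr_ge0.
apply: le_trans h _; rewrite mulrC; apply: ler_pM => //.
  by rewrite addr_ge0 ?(mulr_ge0 ln0 d0) // divr_ge0.
by rewrite lerD2r ler_wpM2r.
Qed.

End Bridge.

Theorem theorem1p1 (R : realType) (n : nat) (n_gt0 : (0 < n)%N) :
  (max_growth R n <=
    ((n%:R : R) `^ (ln (n%:R : R) / (2 * (2 + (2 - Num.sqrt 2) * ln 2))
                    + 91 / 100))%:E)%E.
Proof.
case: n n_gt0 => // n _.
apply: ge_ereal_sup => _ [A cp <-]; rewrite lee_fin.
exact: growth_le.
Qed.
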